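(* There exists a function $f:\mathbb{N}\to\mathbb{N}$ such that the following holds. Let $j\geq 2$ and $m\geq 1$ be integers and let $G$ be a finite group that possesses $m$ cyclic subgroups whose union contains all $\delta_j^*$-commutators of $G$. Then the order of $\delta_j^*(G)$ is at most $f(m)$.
   Context: Let $G$ be a finite group; $|a|$ denotes the order of an element $a$ and $[a,b]=a^{-1}b^{-1}ab$. The $\delta_j^*$-commutators of $G$ are defined recursively. Every element of $G$ is a $\delta_0^*$-commutator. For $j\geq 1$, let $Y$ be the set of all elements of $G$ that are powers of $\delta_{j-1}^*$-commutators; an element $g\in G$ is a $\delta_j^*$-commutator if there exist $a,b\in Y$ such that $g=[a,b]$ and $(|a|,|b|)=1$. The subgroup of $G$ generated by all $\delta_j^*$-commutators is denoted by $\delta_j^*(G)$. The function $f$ expresses that the order is ''$m$-bounded'', i.e. bounded by a function of $m$ only (independent of $j$ and $G$). *)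

(* Defs.v *)
From mathcomp Require Import all_boot all_fingroup all_solvable.
Set Implicit Arguments.
Unset Strict Implicit.
Unset Printing Implicit Defensive.

Local Open Scope group_scope.

(* The powers of [x] (with integer exponents) are the elements of [<[x]>]. *)
Definition powers_of (gT : finGroupType) (D : {set gT}) : {set gT} :=
  \bigcup_(x in D) <[x]>.

(* [~ a, b] = a^-1 * b^-1 * a * b, by [commgEl] and [conjgE]. *)
Fixpoint delta_star_comms (gT : finGroupType) (G : {set gT}) (j : nat) :
    {set gT} :=
  if j is j'.+1 then
    let Y := powers_of (delta_star_comms G j') in
    [set [~ a, b] | a in Y, b in Y & coprime #[a] #[b]]
  else G.

Definition delta_star (gT : finGroupType) (G : {set gT}) (j : nat) :
    {set gT} :=
  <<delta_star_comms G j>>.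

(* Main.v *)
Require Import Defs.
From mathcomp Require Import all_boot all_fingroup all_solvable.
From mathcomp Require Import ssralg finalg zmodp matrix mxalgebra.
From mathcomp Require Import mxrepresentation mxabelem.
Set Implicit Arguments.
Unset Strict Implicit.
Unset Printing Implicit Defensive.

(** Write D for the set of commutators at level j, Y for the powers of those at
    level j - 1, K for the subgroup generated by D, and q = m!.

    It suffices to bound the exponent of K: at most m * e elements of m cyclic
    groups have order dividing e, so D is then a normal set of bounded size,
    made of elements of bounded order, and such a set generates a group of
    bounded order ([card_gen_normal_set]).

    Let P be an abelian normal p-subgroup of G, and a a p'-element of Y. The
    group [P, a] consists of the commutators [v, a] with v in [P, a], hence it
    lies in D ([coprime_comm_sub_delta]); being abelian and covered by m cyclic
    groups, it has a cyclic subgroup of index at most m, so its q-th powers lie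
    in a cyclic group. As j > 1, a is a power of a commutator of G, hence acts
    with determinant 1 on every elementary abelian section of P. An element of
    order prime to p with determinant 1 cannot move just one dimension, so a
    must centralize all q-th powers of P ([power_cent_of_covered]). This is
    where j = 1 fails: in a dihedral group the reflections have determinant -1.

    A commutator of elements of coprime orders has an entry of order prime to p,
    so K centralizes any element that the p'-elements of Y centralize
    ([coprime_cent_delta]). The bound on the exponent rests on two facts.

    First, some bounded power of each x in D is central in K. The subgroup <x>
    has at most m conjugates, because a cyclic group has at most one subgroup of
    each order; hence the elements of G that normalize all the <x> form a normal
    subgroup G0 that contains all q-th powers. Commutators of G0 centralize each
    <x>, so N = K :&: G0 is nilpotent with N' central in K. Applying the
    previous paragraphs to P / P' and then to P', where P = O_p(N), shows that K
    centralizes the q^2-th powers of P ([power_central]). Hence K / Z(K) is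
    generated by a bounded normal set of elements of bounded order, and it has
    bounded order n.

    Second, the q-th powers of the elements of D lie in K'. To see this one may
    pass to a quotient of G in which K is an abelian p-group. There D is
    contained in the union of the groups [K, c], for c a p'-element of Y, since
    [b, c] can be corrected by an element of K to a p-element that commutes with
    c, and then it is trivial. In [K, c] the q-th powers are both centralized by
    c and in the fixed-point-free part of the action of c, so they are trivial
    ([coprime_comm_exponent]).

    Finally the transfer of K into its centre is the power map of exponent n and
    kills K', so the elements of D have order dividing q * n. *)

Section General.
Local Open Scope group_scope.

Variable gT : finGroupType.
Implicit Types (x y : gT) (D : {set gT}).

(** * Groups generated by a finite normal set *)

(** In a product of elements of a normal set, all the occurrences of a letter
    can be moved to the front: the letters they pass are only conjugated, hence
    stay in the set. *)
Lemma extract_letter D y (w : seq gT) :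
  {in D &, forall a b, a ^ b \in D} -> y \in D -> {subset w <= D} ->
  exists2 w' : seq gT, {subset w' <= D} /\ (size w' + count_mem y w = size w)%N
    & \prod_(z <- w) z = y ^+ count_mem y w * \prod_(z <- w') z.
Proof.
move=> DJ Dy; elim: w => [|z w IHw] sD.
  by exists [::]; rewrite ?big_nil ?mulg1.
have [|w' [sw'D sz_w'] def_w] := IHw.
  by move=> t wt; rewrite sD ?inE ?wt ?orbT.
rewrite big_cons def_w /=; case: eqVneq => [-> | _].
  exists w'; last by rewrite add1n expgS mulgA.
  by split=> //; rewrite addnCA sz_w'.
rewrite add0n; set c := count_mem y w in sz_w' *.
have DJX t: t \in D -> t ^ (y ^+ c) \in D.
  move=> Dt; elim: (c) => [|k IHk]; first by rewrite conjg1.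
  by rewrite expgSr conjgM DJ.
exists (z ^ (y ^+ c) :: w').
  2: by rewrite big_cons conjgE !mulgA mulgV mul1g.
split; last by rewrite /= addSn sz_w'.
by move=> t; rewrite inE => /predU1P[-> | /sw'D//]; rewrite DJX ?sD ?mem_head.
Qed.

(** A word of more than n * e letters has a letter that occurs at least e times;
    moving e occurrences to the front, where they cancel, shortens the word. *)
Lemma short_word D n e x :
    {in D &, forall a b, a ^ b \in D} -> #|D| <= n -> 0 < e ->
    {in D, forall y, y ^+ e = 1} -> x \in <<D>> ->
  exists2 w : seq gT, {subset w <= D} /\ size w <= n * e & x = \prod_(z <- w) z.
Proof.
move=> DJ leDn e_gt0 De1 /gen_prodgP[k [c Dc def_x]].
pose w := [seq c i | i <- index_enum 'I_k].
have sw: {subset w <= D} by move=> _ /mapP[i _ ->].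
have {def_x}: x = \prod_(z <- w) z by rewrite big_map.
move: w sw => {Dc} w sw def_x.
have [s le_s] := ubnP (size w).
elim: s => // s IHs in w sw def_x le_s *.
have [sz_w|] := leqP (size w) (n * e); first by exists w.
have [/existsP[y /andP[Dy le_e]] _ | noD] := boolP
    [exists y, (y \in D) && (e <= count_mem y w)].
  have [w' [sw' sz_w'] def_w] := extract_letter DJ Dy sw.
  apply: (IHs (nseq (count_mem y w - e) y ++ w')).
  - by move=> z; rewrite mem_cat => /orP[/nseqP[-> _] | /sw'].
  - rewrite def_x def_w big_cat -{1}(subnK le_e) expgD De1 // mulg1;
      congr (_ * _).
    by elim: (_ - e)%N => [|i IHi]; rewrite ?big_nil // expgS big_cons IHi.
  rewrite size_cat size_nseq; move: le_s; rewrite ltnS => /(leq_trans _)->//.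
  by rewrite -sz_w' addnC ltn_add2l ltn_subrL e_gt0 (leq_trans e_gt0).
rewrite ltnNge => /negP[].
have ->: size w = (\sum_(y in D) count_mem y w)%N.
  elim: (w) sw => [|z v IHv] sv /=; first by rewrite big1.
  rewrite IHv => [|t vt]; last by rewrite sv ?inE ?vt ?orbT.
  rewrite big_split /= -add1n; congr addn.
  rewrite (bigD1 z) ?sv ?mem_head //= eqxx big1 // => t /andP[_ /negPf].
  by rewrite eq_sym => ->.
apply: leq_trans (leq_mul leDn (leqnn e)); rewrite -sum_nat_const.
apply: leq_sum => y Dy; apply: contraR noD; rewrite -ltnNge => /ltnW lt_e.
by apply/existsP; exists y; rewrite Dy.
Qed.

(** Dietzmann's lemma, in a quantitative form. *)
Lemma card_gen_normal_set D n e :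
    {in D &, forall a b, a ^ b \in D} -> #|D| <= n -> 0 < e ->
    {in D, forall y, y ^+ e = 1} ->
  #|<<D>>| <= n.+1 ^ (n * e).
Proof.
move=> DJ leDn e_gt0 De1; pose A := 1 |: D.
have leA k: #|A ^+ k| <= n.+1 ^ k.
  elim: k => [|k IHk]; first by rewrite cards1.
  rewrite expgS expnS /mulg /= /set_mulg curry_imset2X.
  rewrite (leq_trans (leq_imset_card _ _)) // cardsX leq_mul //.
  by rewrite (leq_trans (leq_card_setU _ _)) // cards1.
apply: leq_trans (leA _); apply/subset_leq_card/subsetP=> x Dx.
have [w [sw +] ->] := short_word DJ leDn e_gt0 De1 Dx.
move: (n * e)%N => N; elim: N w sw => [|N IHN] [|z w] //= sw le_w.
- by rewrite big_nil inE.
- have /(_ isT) := IHN [::] sw; rewrite big_nil expgS => A1.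
  by rewrite -[1 in X in X \in _]mulg1 mem_mulg ?setU11.
rewrite big_cons expgS mem_mulg ?IHN //.
  by rewrite !inE sw ?mem_head ?orbT.
by move=> t wt; rewrite sw // inE wt orbT.
Qed.

(** * Sets covered by a given number of cyclic subgroups *)

Definition cyclically_covered m D :=
  exists2 C : 'I_m -> {group gT},
    forall i, cyclic (C i) & D \subset \bigcup_(i < m) C i.

Lemma cyclically_coveredS m D1 D2 :
  D1 \subset D2 -> cyclically_covered m D2 -> cyclically_covered m D1.
Proof. by move=> sD [C cycC sDC]; exists C; last apply: subset_trans sDC. Qed.

Lemma card_Ldiv_cyclic (C : {group gT}) e :
  cyclic C -> 0 < e -> #|'Ldiv_e(C)| <= e.
Proof.
move=> cycC e_gt0; pose L := Group (group_Ldiv e (cyclic_abelian cycC)).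
have [x defL] := cyclicP (cyclicS (subsetIl _ _ : L \subset C) cycC).
have: x \in L by rewrite defL cycle_id.
rewrite !inE -order_dvdn orderE => /andP[_ /(dvdn_leq e_gt0)].
by rewrite -defL.
Qed.

Lemma expg_fact_mem (A B : {group gT}) m x :
  abelian A -> B \subset A -> #|A : B| <= m -> x \in A -> x ^+ m`! \in B.
Proof.
move=> cAA sBA le_m Ax; have nBA := sub_abelian_norm cAA sBA.
apply: coset_idr; first by rewrite groupX ?(subsetP nBA).
rewrite morphX ?(subsetP nBA) //; apply/eqP; rewrite -order_dvdn.
apply: dvdn_trans (order_dvdG (mem_quotient B Ax)) _.
by rewrite card_quotient // dvdn_fact // indexg_gt0.
Qed.

Lemma card_covered m D e :
  cyclically_covered m D -> 0 < e -> {in D, forall x, x ^+ e = 1} ->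
  #|D| <= m * e.
Proof.
case=> C cycC sDC e_gt0 De1.
have sD: D \subset \bigcup_(i < m) 'Ldiv_e(C i).
  apply/subsetP=> x Dx; have /bigcupP[i _ Cix] := subsetP sDC x Dx.
  by apply/bigcupP; exists i; rewrite // !inE Cix De1 /=.
apply: leq_trans (subset_leq_card sD) _.
suff: #|\bigcup_(i < m) 'Ldiv_e(C i)| <= \sum_(i < m) e.
  by rewrite sum_nat_const card_ord.
elim/big_ind2: _ => [|A a B b leA leB|i _]; first by rewrite cards0.
  by rewrite (leq_trans (leq_card_setU _ _)) ?leq_add.
exact: card_Ldiv_cyclic.
Qed.

(** By counting, one of the m cyclic subgroups meets Q in a subgroup of index at
    most m. *)
Lemma covered_abelian_power_cyclic m (Q : {group gT}) :
  abelian Q -> cyclically_covered m Q ->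
  exists2 C : {group gT}, cyclic C & {in Q, forall x, x ^+ m`! \in C}.
Proof.
move=> cQQ [C cycC sQC].
have m_gt0: 0 < m.
  by have /bigcupP[[i lt_im] _ _] := subsetP sQC 1 (group1 Q);
    apply: leq_ltn_trans lt_im.
have [i le_i]: exists i, #|Q : C i| <= m.
  pose i0 := Ordinal m_gt0; pose F (i : 'I_m) := #|Q :&: C i|.
  case: (@arg_maxnP _ i0 xpredT F) => // i _ max_i; exists i.
  rewrite -(leq_pmul2l (cardG_gt0 (Q :&: C i))) LagrangeI mulnC.
  have{} sQC: Q \subset \bigcup_(i < m) (Q :&: C i).
    apply/subsetP=> x Qx; have /bigcupP[k _ Ckx] := subsetP sQC x Qx.
    by apply/bigcupP; exists k; rewrite // inE Qx.
  apply: leq_trans (subset_leq_card sQC) _.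
  rewrite -[X in _ <= X * _](card_ord m) -sum_nat_const.
  elim/big_ind2: _ => [|A a B b leA leB|k _]; first by rewrite cards0.
    by rewrite (leq_trans (leq_card_setU _ _)) ?leq_add.
  exact: max_i.
exists (Q :&: C i)%G; first exact: cyclicS (subsetIr _ _) (cycC i).
by move=> x Qx; rewrite (expg_fact_mem cQQ) ?subsetIl ?indexgI.
Qed.

(** The conjugates of <[x]> under <[g]> lie in the m cyclic subgroups, and each
    of these has a single subgroup of order #[x], so there are at most m
    conjugates. *)
Lemma expg_fact_norm_cycle m (S : {set gT}) x g :
    cyclically_covered m S -> (forall h, h \in <[g]> -> x ^ h \in S) ->
  g ^+ m`! \in 'N(<[x]>).
Proof.
case=> C cycC sSC SxJ; pose N := ('N_<[g]>(<[x]>))%G.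
suff: #|<[g]> : N| <= m.
  move/(expg_fact_mem (cycle_abelian g) (subsetIl _ _))/(_ (cycle_id g)).
  by case/setIP.
rewrite -[N : {set gT}]/('N_<[g]>(<[x]>)) -astab1Js -card_orbit.
rewrite -[X in _ <= X]card_ord -cardsT.
(* The subgroup of order n of a cyclic group is the set of its elements of
   order dividing n. *)
apply: leq_trans (leq_imset_card (fun i : 'I_m => 'Ldiv_#[x](C i)) _).
apply/subset_leq_card/subsetP=> _ /imsetP[h gh ->].
have /bigcupP[i _ Cixh] := subsetP sSC _ (SxJ h gh).
apply/imsetP; exists i; rewrite ?inE //=; apply/eqP.
rewrite -cycleJ eqEcard; apply/andP; split.
  apply/subsetP=> _ /cycleP[k ->]; rewrite !inE groupX //= -expgM mulnC expgM.
  by rewrite -(orderJ x h) expg_order expg1n.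
by rewrite -orderE orderJ card_Ldiv_cyclic.
Qed.

(** Automorphisms of a cyclic group are power maps, hence commute. *)
Lemma commg_norm_cycle (x g h : gT) :
  g \in 'N(<[x]>) -> h \in 'N(<[x]>) -> commute [~ g, h] x.
Proof.
move=> Ng Nh.
have /cycleP[i xg]: x ^ g^-1 \in <[x]> by rewrite memJ_norm ?cycle_id ?groupV.
have /cycleP[k xh]: x ^ h^-1 \in <[x]> by rewrite memJ_norm ?cycle_id ?groupV.
have cgh u v r s : x ^ u = x ^+ r -> x ^ v = x ^+ s ->
    x ^ (u * v) = x ^ (v * u).
  by move=> xu xv; rewrite !conjgM xu xv !conjXg xu xv -!expgM mulnC.
apply/commute_sym/commgP/conjg_fixP.
rewrite commgEl conjgE mulgA conjgM (cgh g^-1 h^-1 i k) //.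
by rewrite -conjgM mulgA mulgKV mulVg conjg1.
Qed.

End General.

(** * Coprime action and determinants *)

Section Det.
Import GRing.Theory.
Local Open Scope ring_scope.

(** The Weinstein-Aronszajn identity. *)
Lemma det_1Dmul (R : comNzRingType) n r (u : 'M[R]_(n, r)) (v : 'M_(r, n)) :
  \det (1%:M + u *m v) = \det (1%:M + v *m u).
Proof.
pose L := block_mx 1%:M 0 u 1%:M : 'M_(r + n).
have detL: \det L = 1 by rewrite det_lblock !det1 mulr1.
have eq_L: L *m block_mx 1%:M (- v) 0 (1%:M + u *m v)
           = block_mx (1%:M + v *m u) (- v) 0 1%:M *m L.
  rewrite !mulmx_block !mul0mx !mulmx0 !mul1mx !mulmx1 !addr0 !add0r.
  by rewrite mulNmx mulmxN addrK addrC addrK.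
move/(congr1 determinant): eq_L; rewrite !det_mulmx !det_ublock detL.
by rewrite !det1 !mul1r !mulr1.
Qed.

(** A matrix of determinant 1 that differs from the identity by a matrix of rank
    1 is a transvection: writing it as 1 + u *m v, its determinant is
    1 + v *m u, so v *m u = 0. *)
Lemma rank1_det1_sqr0 (F : fieldType) n (A : 'M[F]_n) :
  (\rank (A - 1%:M)%R <= 1)%N -> \det A = 1 -> (A - 1%:M) *m (A - 1%:M) = 0.
Proof.
move: (mulmx_base (A - 1%:M)%R); set B := A - 1%:M => defB rB.
have ->: A = 1%:M + B by rewrite addrC subrK.
move: (col_base B) (row_base B) defB rB.
case: (\rank B) => [|[|r]] // u v <- _; first by rewrite thinmx0 !mul0mx.
rewrite det_1Dmul det_mx11 mxE [X in X + _]mxE eqxx => /(canRL (addKr _)).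
rewrite addNr => vu0; rewrite mulmxA -(mulmxA u) [v *m u]mx11_scalar vu0.
by rewrite raddf0 mulmx0 mul0mx.
Qed.

End Det.

Section CentRank1.
Local Open Scope group_scope.

Lemma coprime_p'elt (gT : finGroupType) (p : nat) (a b : gT) :
  prime p -> coprime #[a] #[b] -> p^'.-elt a \/ p^'.-elt b.
Proof.
move=> p_pr co_ab; rewrite /p_elt !p'natE //; case: (boolP (p %| #[a])).
  2: by left.
by move=> /coprime_dvdl/(_ co_ab); rewrite prime_coprime //; right.
Qed.

(** If z = [~ y, a] commutes with a then y ^ (a ^+ k) = y * z ^+ k, so the order
    of z divides that of a. *)
Lemma coprime_comm1 (gT : finGroupType) (y a : gT) :
  commute [~ y, a] a -> coprime #[[~ y, a]] #[a] -> [~ y, a] = 1.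
Proof.
move=> cza co_za; set z := [~ y, a] in cza co_za *.
have y_ak k: y ^ (a ^+ k) = y * z ^+ k.
  elim: k => [|k IHk]; first by rewrite conjg1 mulg1.
  rewrite expgSr conjgM IHk conjMg conjXg (conjg_fixP (introT commgP cza)).
  by rewrite expgS mulgA conjg_mulR.
have /eqP: z ^+ #[a] = 1.
  by apply: (mulgI y); rewrite mulg1 -y_ak expg_order conjg1.
by rewrite -order_dvdn => /gcdn_idPl; rewrite (eqP co_za) => /esym/eqP;
  rewrite order_eq1 => /eqP.
Qed.

Lemma abelian_commM (gT : finGroupType) (P : {group gT}) a :
  abelian P -> a \in 'N(P) -> {in P &, {morph commg^~ a : x y / x * y}}.
Proof.
move=> cPP nPa x y Px Py; rewrite commMgJ (conjgE [~ x, a]).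
rewrite -(centsP cPP _ Py) ?mulKg // groupMl ?groupV //.
by rewrite memJ_norm.
Qed.

(** The map sending v to [~ v, a] is an endomorphism of P; on [~: P, <[a]>] it
    is injective because a has no nontrivial fixed point there, hence
    surjective. *)
Lemma coprime_comm_onto (gT : finGroupType) (P : {group gT}) a w :
    abelian P -> a \in 'N(P) -> coprime #|P| #[a] -> w \in [~: P, <[a]>] ->
  exists2 v, v \in [~: P, <[a]>] & w = [~ v, a].
Proof.
move=> cPP nPa coPa; set Q := [~: P, _] => Qw.
have nPA: <[a]> \subset 'N(P) by rewrite cycle_subG.
have sQP: Q \subset P by rewrite commg_subl.
have nQa: a \in 'N(Q) by rewrite -cycle_subG commg_normr.
have TI := coprime_abel_cent_TI nPA coPa cPP.
have sfQ: commg^~ a @: Q \subset Q.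
  apply/subsetP=> _ /imsetP[v Qv ->].
  by rewrite groupMl ?groupV // memJ_norm.
suff /eqP fQ: commg^~ a @: Q == Q.
  by have := Qw; rewrite -{1}fQ => /imsetP[v Qv ->]; exists v.
rewrite eqEcard sfQ /= card_in_imset // => u v Qu Qv /= eq_uv.
have [Pu Pv] := (subsetP sQP u Qu, subsetP sQP v Qv).
apply/eqP; rewrite eq_mulgV1 -in_set1 -[[set 1]]TI inE groupM ?groupV //=
  cent_cycle.
apply/cent1P/commgP; rewrite (abelian_commM cPP) ?groupV // eq_uv.
by rewrite -(abelian_commM cPP) ?groupV // mulgV comm1g.
Qed.

(** On the vector space V, a acts with determinant 1 since it is a power of a
    commutator, and a - 1 has rank at most 1 since [V, a] is cyclic. So a acts
    as a transvection; its order being prime to p, it acts trivially. *)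
Lemma cent_cyclic_commutator (gT : finGroupType) (G V C : {group gT}) p a b c :
    p.-abelem V -> G \subset 'N(V) -> b \in G -> c \in G ->
    a \in <[ [~ b, c] ]> -> p^'.-elt a -> cyclic C ->
    {in V, forall v, [~ v, a] \in C} ->
  a \in 'C(V).
Proof.
move=> abelV nVG Gb Gc bc_a p'a cycC VaC.
have [->|ntV] := eqsVneq V 1; first by rewrite cent1T inE.
have Ga: a \in G by rewrite (subsetP _ _ bc_a) // cycle_subG groupR.
have p_pr: prime p by have [] := pgroup_pdiv (abelem_pgroup abelV) ntV.
pose rG := abelem_repr abelV ntV nVG.
pose d x : 'F_p := (\det (rG x))%R.
have dM: {in G &, forall x y, d (x * y) = (d x * d y)%R}.
  by move=> x y Gx Gy; rewrite /d repr_mxM // det_mulmx.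
have d1: d 1 = 1%R by rewrite /d repr_mx1 det1.
have det_a: d a = 1%R.
  have /cycleP[k ->] := bc_a.
  elim: k => [|k IHk] //; rewrite expgSr dM ?groupX ?groupR // IHk GRing.mul1r.
  rewrite commgEl conjgE !dM ?groupM ?groupV // GRing.mulrCA.
  by rewrite (GRing.mulrA (d b^-1)) -!dM ?groupM ?groupV // mulVg mul1g mulVg.
have comm_rV v: v \in V ->
  abelem_rV abelV ntV [~ v, a] = (abelem_rV abelV ntV v *m (rG a - 1%:M))%R.
  move=> Vv; have Vva: v ^ a \in V by rewrite memJ_norm ?(subsetP nVG).
  rewrite commgEl abelem_rV_M ?groupV // abelem_rV_V //.
  by rewrite (abelem_rV_J _ _ nVG) // mulmxBr mulmx1 GRing.addrC.
(* The vectors of the row space of a - 1 correspond to the elements [~ v, a]. *)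
have le_rank: (\rank (rG a - 1%:M)%R <= 1)%N.
  rewrite -(leq_exp2l _ _ (prime_gt1 p_pr)) expn1.
  have abelVC := abelemS (subsetIl V C) abelV.
  have leVC: #|V :&: C| <= p.
    have:= cyclicS (subsetIr V C) cycC; rewrite (abelem_cyclic abelVC).
    rewrite -(leq_exp2l _ _ (prime_gt1 p_pr)) expn1 -p_part.
    by rewrite part_pnat_id //; apply: abelem_pgroup abelVC.
  apply: leq_trans leVC; rewrite -{1}(card_Fp p_pr) -card_rowg.
  apply: leq_trans (leq_imset_card (abelem_rV abelV ntV) _).
  apply/subset_leq_card/subsetP=> w; rewrite mem_rowg => /submxP[u ->].
  rewrite -(rVabelemK abelV ntV u) -comm_rV ?mem_rVabelem // imset_f //.
  rewrite inE VaC ?mem_rVabelem // andbT.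
  rewrite groupMl ?groupV ?mem_rVabelem //.
  by rewrite memJ_norm ?mem_rVabelem ?(subsetP nVG).
have sqr0 := rank1_det1_sqr0 le_rank det_a.
apply/centP=> v Vv; apply/esym/commgP/eqP.
have Vva: [~ v, a] \in V.
  by rewrite groupMl ?groupV // memJ_norm ?(subsetP nVG).
apply: coprime_comm1.
  apply/commgP/eqP; apply: (@abelem_rV_inj _ _ _ abelV ntV); rewrite ?group1 //.
    by rewrite groupMl ?groupV // memJ_norm ?(subsetP nVG).
  by rewrite !comm_rV // -mulmxA sqr0 mulmx0 abelem_rV_1.
exact: pnat_coprime (mem_p_elt (abelem_pgroup abelV) Vva) p'a.
Qed.
End CentRank1.

(** * Transfer into the centre *)

Section Transfer.
Import FiniteModule.
Local Open Scope group_scope.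

(** The transfer of K into its centre maps y to y ^+ #|K : 'Z(K)|, and K^`(1) is
    in the kernel of any morphism to an abelian group. This is the part of
    Schur's theorem that concerns the exponent. *)
Lemma expg_index_center_der1 (gT : finGroupType) (K : {group gT}) x :
  x \in K^`(1) -> x ^+ #|K : 'Z(K)| = 1.
Proof.
pose Z := 'Z(K)%G; have sZK: Z \subset K by apply: center_sub.
have cZ z: z \in Z -> {in K, forall y, z ^ y = z}.
  by move=> /centerP[Kz cz] y Ky; apply/conjg_fixP/commgP/cz.
have abZ: abelian (idm Z @* Z) by rewrite morphim_idm ?center_abelian.
have imZ z: z \in Z -> z \in (idm Z @* Z)%G by rewrite /= morphim_idm.
pose V := transfer_morphism K abZ.
have VE y: y \in K -> V y = fmod abZ (y ^+ #|K : Z|) /\ y ^+ #|K : Z| \in Z.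
  move=> Ky; have trX := transversalP (rcosets_cycle_partition sZK Ky).
  rewrite -(sum_index_rcosets_cycle sZK Ky trX) /V /=.
  rewrite (transfer_cycle_expansion sZK abZ Ky trX).
  apply: (big_rec2 (fun s k => s = fmod abZ (y ^+ k) /\ y ^+ k \in Z)).
    by rewrite expg0 fmod1.
  move=> t k s /(subsetP (transversal_sub trX)) Kt [-> Zyk].
  have Zyt: y ^+ #|<[y]> : Z :* t| \in Z.
    set w := y ^+ _; have Zwt: w ^ t^-1 \in Z.
      by rewrite conjgE invgK mulgA -mem_rcoset mulg_exp_card_rcosets.
    by rewrite -(conjgKV t w) cZ.
  rewrite /= cZ ?groupV // expgD fmodM ?imZ //.
  by split; last exact: groupM.
move=> K'x; have Kx := subsetP (der_sub 1 K) x K'x.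
have [Vx Zxn] := VE x Kx.
have: V x \in V @* K^`(1) by rewrite mem_morphim.
rewrite morphim_der // (derG1P _) ?FinRing.zmod_abelian // => /set1P.
by rewrite Vx => /(congr1 val); rewrite fmodK ?imZ // => ->.
Qed.

End Transfer.

(** * General properties of the sets of commutators *)

Section Delta.
Local Open Scope group_scope.

Lemma powers_ofP (gT : finGroupType) (D : {set gT}) x :
  reflect (exists2 y, y \in D & x \in <[y]>) (x \in powers_of D).
Proof. exact: bigcupP. Qed.

Lemma sub_powers_of (gT : finGroupType) (D : {set gT}) : D \subset powers_of D.
Proof.
by apply/subsetP=> x Dx; apply/powers_ofP; exists x; rewrite ?cycle_id.
Qed.

Lemma powers_ofS (gT : finGroupType) (D1 D2 : {set gT}) :
  D1 \subset D2 -> powers_of D1 \subset powers_of D2.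
Proof.
move=> sD; apply/subsetP=> x /powers_ofP[y /(subsetP sD) Dy yx].
by apply/powers_ofP; exists y.
Qed.

Lemma powers_of_cycle (gT : finGroupType) (D : {set gT}) x y :
  x \in powers_of D -> y \in <[x]> -> y \in powers_of D.
Proof.
move=> /powers_ofP[z Dz zx] xy; apply/powers_ofP; exists z => //.
by apply: subsetP xy; rewrite cycle_subG.
Qed.

Lemma powers_ofJ (gT : finGroupType) (D : {set gT}) x g :
  (forall y, y \in D -> y ^ g \in D) -> x \in powers_of D ->
  x ^ g \in powers_of D.
Proof.
move=> DJ /powers_ofP[z Dz zx]; apply/powers_ofP; exists (z ^ g);
  first exact: DJ.
by rewrite cycleJ memJ_conjg.
Qed.

Lemma powers_of_group (gT : finGroupType) (G : {group gT}) : powers_of G = G.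
Proof.
apply/eqP; rewrite eqEsubset sub_powers_of andbT; apply/bigcupsP=> x Gx.
by rewrite cycle_subG.
Qed.

Lemma delta_star_commsP (gT : finGroupType) (G : {set gT}) j x :
  reflect (exists a b, [/\ a \in powers_of (delta_star_comms G j),
     b \in powers_of (delta_star_comms G j), coprime #[a] #[b] & x = [~ a, b]])
   (x \in delta_star_comms G j.+1).
Proof.
apply: (iffP imset2P) => [[a b Ya /[!inE]/andP[Yb co_ab] ->]|].
  by exists a, b.
by case=> a [b [Ya Yb co_ab ->]]; exists a b; rewrite ?inE ?Yb.
Qed.

Section OneGroup.
Variables (gT : finGroupType) (G : {group gT}).
Notation D := (delta_star_comms G).
Notation Y j := (powers_of (D j)).

Lemma delta_star_comms_sub j : D j \subset G.
Proof.
elim: j => [|j IHj] //; apply/subsetP=> x.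
case/delta_star_commsP=> a [b [Ya Yb _ ->]].
have sYG: Y j \subset G by rewrite -{2}(powers_of_group G) powers_ofS.
by rewrite groupR ?(subsetP sYG).
Qed.

Lemma powers_of_delta_sub j : Y j \subset G.
Proof. by rewrite -{2}(powers_of_group G) powers_ofS ?delta_star_comms_sub. Qed.

Lemma delta_star_comms_decr i j : i <= j -> D j \subset D i.
Proof.
have decr k: D k.+1 \subset D k.
  elim: k => [|k IHk]; first exact: delta_star_comms_sub.
  apply/subsetP=> x /delta_star_commsP[a [b [Ya Yb co_ab ->]]].
  by apply/delta_star_commsP; exists a, b; rewrite !(subsetP (powers_ofS IHk)).
move/subnK <-; elim: (j - i)%N => [|k IHk] //; exact: subset_trans (decr _) IHk.
Qed.

Lemma delta_star_commsJ j g x : g \in G -> x \in D j -> x ^ g \in D j.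
Proof.
move=> Gg; elim: j x => [|j IHj] x; first by move=> Gx; rewrite groupJ.
case/delta_star_commsP=> a [b [Ya Yb co_ab ->]]; apply/delta_star_commsP.
by exists (a ^ g), (b ^ g); rewrite !orderJ conjRg !powers_ofJ.
Qed.

Lemma powers_of_deltaJ j g x : g \in G -> x \in Y j -> x ^ g \in Y j.
Proof. by move=> Gg; apply: powers_ofJ => y; apply: delta_star_commsJ. Qed.

Lemma delta_star_normal j : <<D j>>%G <| G.
Proof.
rewrite /normal gen_subG delta_star_comms_sub norms_gen //.
apply/subsetP=> g Gg; rewrite inE; apply/subsetP=> _ /imsetP[x Dx ->].
exact: delta_star_commsJ.
Qed.

Lemma powers_of_delta_commutator j a :
  a \in Y j.+1 -> exists b c, [/\ b \in G, c \in G & a \in <[ [~ b, c] ]>].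
Proof.
case/powers_ofP=> _ /delta_star_commsP[b [c [Yb Yc _ ->]]] bc_a.
by exists b, c; rewrite !(subsetP (powers_of_delta_sub j)).
Qed.

Lemma powers_of_quotient (H : {group gT}) (A : {set gT}) :
  A \subset 'N(H) -> powers_of (coset H @: A) = coset H @: powers_of A.
Proof.
move=> /subsetP nHA; apply/setP=> x; apply/powers_ofP/imsetP.
  case=> _ /imsetP[y Ay ->] /cycleP[i ->].
  exists (y ^+ i); last by rewrite morphX ?nHA.
  by apply/powers_ofP; exists y; rewrite ?mem_cycle.
case=> _ /powers_ofP[y Ay /cycleP[i ->]] ->; exists (coset H y);
  first exact: imset_f.
by rewrite morphX ?mem_cycle ?nHA.
Qed.

(** Elements of coprime orders in the quotient lift to elements of coprime
    orders: any lift a can be replaced by its pi-part, pi being the set of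
    primes that divide the order of its image. The pi-part is a power of a, and
    the sets [powers_of _] are closed under powers. *)
Lemma delta_star_comms_quotient (H : {group gT}) j :
  H <| G -> delta_star_comms (G / H) j = coset H @: D j.
Proof.
move=> nsHG; have nHG := subsetP (normal_norm nsHG).
elim: j => [|j IHj]; first by rewrite /= -morphimEsub ?normal_norm.
have sYG := subsetP (powers_of_delta_sub j).
apply/setP=> x; apply/delta_star_commsP/imsetP=> [|[y Dy ->]]; last first.
  case/delta_star_commsP: Dy => a [b [Ya Yb co_ab def_y]]; rewrite {}def_y.
  have [Na Nb] := (nHG _ (sYG a Ya), nHG _ (sYG b Yb)).
  exists (coset H a), (coset H b); rewrite IHj powers_of_quotient; last first.
    exact: subset_trans (delta_star_comms_sub j) (normal_norm nsHG).
  rewrite !imset_f // morphR //; split=> //.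
  by apply: coprime_dvdl (coprime_dvdr _ co_ab); apply: morph_order.
rewrite IHj powers_of_quotient; last first.
  exact: subset_trans (delta_star_comms_sub j) (normal_norm nsHG).
case=> [_ [_ [/imsetP[a Ya ->] /imsetP[b Yb ->] co_ab ->]]].
have [Na Nb] := (nHG _ (sYG a Ya), nHG _ (sYG b Yb)).
pose a' := a.`_\pi(#[coset H a]); pose b' := b.`_\pi(#[coset H b]).
have Ya': a' \in Y j by rewrite (powers_of_cycle Ya) ?mem_cycle.
have Yb': b' \in Y j by rewrite (powers_of_cycle Yb) ?mem_cycle.
have ca': coset H a' = coset H a.
  by rewrite /a' morph_constt // constt_p_elt ?/p_elt ?pnat_pi.
have cb': coset H b' = coset H b.
  by rewrite /b' morph_constt // constt_p_elt ?/p_elt ?pnat_pi.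
exists [~ a', b']; last by rewrite -ca' -cb' -morphR ?nHG ?sYG.
apply/delta_star_commsP; exists a', b'; split=> //.
apply: pnat_coprime (p_elt_constt _ _) _.
apply: sub_in_pnat (p_elt_constt _ _) => p _.
by move=> pi_p; apply: pnatPpi pi_p; rewrite -coprime_pi'.
Qed.

Lemma mem_powers_of_delta_quotient (H : {group gT}) j x :
  H <| G -> x \in Y j -> coset H x \in powers_of (delta_star_comms (G / H) j).
Proof.
move=> nsHG Yx; rewrite delta_star_comms_quotient // powers_of_quotient.
  exact: imset_f.
exact: subset_trans (delta_star_comms_sub j) (normal_norm nsHG).
Qed.

Lemma delta_star_quotient (H : {group gT}) j :
  H <| G -> delta_star (G / H) j = delta_star G j / H.
Proof.
move=> nsHG; have nHG := normal_norm nsHG.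
rewrite /delta_star delta_star_comms_quotient //.
have nHD := subset_trans (delta_star_comms_sub j) nHG.
by rewrite -morphimEsub // quotientE morphim_gen.
Qed.

Lemma covered_quotient m (H : {group gT}) j :
  H <| G -> cyclically_covered m (D j) ->
  cyclically_covered m (delta_star_comms (G / H) j).
Proof.
move=> nsHG [C cycC sDC]; exists (fun i => C i / H)%G => [i|];
  first exact: quotient_cyclic.
rewrite delta_star_comms_quotient //; apply/subsetP=> _ /imsetP[x Dx ->].
have /bigcupP[i _ Cix] := subsetP sDC x Dx.
by apply/bigcupP; exists i; rewrite // mem_quotient.
Qed.

(** * Coprime action on abelian normal p-subgroups *)

(** By induction on the level: if Q = [~: P, <[a]>] is contained in D i then
    each of its elements is [~ v, a] with v in Q, hence lies in D i.+1. *)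
Lemma coprime_comm_sub_delta (P : {group gT}) j a :
    abelian P -> P \subset G -> a \in 'N(P) -> coprime #|P| #[a] -> a \in Y j ->
  [~: P, <[a]>] \subset D j.+1.
Proof.
move=> cPP sPG nPa coPa Ya; have sQP: [~: P, <[a]>] \subset P.
  by rewrite commg_subl cycle_subG.
suff sQD i: i <= j.+1 -> [~: P, <[a]>] \subset D i by apply: sQD.
elim: i => [_|i IHi lt_ij]; first exact: subset_trans sPG.
apply/subsetP=> w Qw; have [v Qv ->] := coprime_comm_onto cPP nPa coPa Qw.
apply/delta_star_commsP; exists v, a; split=> //.
- by apply: (subsetP (sub_powers_of _)); apply: (subsetP (IHi (ltnW lt_ij))).
- by apply: subsetP Ya; rewrite powers_ofS ?delta_star_comms_decr.
by apply: coprime_dvdl coPa; rewrite order_dvdG ?(subsetP sQP).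
Qed.

(** The q-th powers of order dividing p form a normal elementary abelian
    subgroup V, and [~ v, a] lies in a cyclic group for all v in V. Hence a
    centralizes V. If [~ x ^+ q, a] were nontrivial, one of its powers would be
    an element of order p of V :&: [~: P, <[a]>], contradicting the fact that a
    has no nontrivial fixed point in [~: P, <[a]>]. *)
Lemma power_cent_of_covered m j (P : {group gT}) (p : nat) a x :
    cyclically_covered m (D j.+2) -> p.-group P -> abelian P -> P <| G ->
    a \in Y j.+1 -> p^'.-elt a -> x \in P ->
  [~ x ^+ m`!, a] = 1.
Proof.
move=> cov pP cPP /andP[sPG nPG] Ya p'a Px; set q := m`!.
have Ga := subsetP (powers_of_delta_sub j.+1) a Ya.
have nPa: a \in 'N(P) := subsetP nPG a Ga.
have coPa: coprime #|P| #[a] := pnat_coprime pP p'a.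
pose Q := [~: P, <[a]>]%G.
have sQD: Q \subset D j.+2 by apply: coprime_comm_sub_delta Ya.
have sQP: Q \subset P by rewrite commg_subl cycle_subG.
have [C cycC QqC] := covered_abelian_power_cyclic (abelianS sQP cPP)
  (cyclically_coveredS sQD cov).
have [b [c [Gb Gc bc_a]]] := powers_of_delta_commutator Ya.
have Qcomm v: v \in P -> [~ v, a] \in Q.
  by move=> Pv; rewrite mem_commg ?cycle_id.
have commX v i: v \in P -> [~ v ^+ i, a] = [~ v, a] ^+ i.
  move=> Pv; elim: i => [|i IHi]; first by rewrite comm1g.
  by rewrite !expgS (abelian_commM cPP) ?groupX ?IHi.
pose V0 := [set x ^+ q | x in P & x ^+ q ^+ p == 1].
have V0P v: reflect (exists2 u, u \in P & v = u ^+ q /\ v ^+ p = 1) (v \in V0).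
  apply: (iffP imsetP) => [[u /[!inE]/andP[Pu /eqP up1] ->]|[u Pu [def_v v1]]].
    by exists u.
  by exists u; rewrite // inE Pu -def_v v1 /=.
have gV0: group_set V0.
  apply/group_setP; split=> [|_ _ /V0P[u Pu [-> up1]] /V0P[v Pv [-> vp1]]].
    by apply/V0P; exists 1; rewrite ?expg1n.
  have cuv: commute u v := centsP cPP u Pu v Pv.
  apply/V0P; exists (u * v); first exact: groupM.
  by rewrite !expgMn ?up1 ?vp1 ?mulg1 //;
    apply/commuteX/commute_sym/commuteX/commute_sym.
pose V := Group gV0.
have [y1 | nty] := eqVneq [~ x ^+ q, a] 1; first by [].
set y := [~ x ^+ q, a] in nty *.
have Qy: y \in Q by rewrite Qcomm ?groupX.
have py: p.-elt y := mem_p_elt pP (subsetP sQP y Qy).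
have [p_pr] := pgroup_pdiv py (etrans (congr1 negb (cycle_eq1 y)) nty).
rewrite -orderE => p_y _.
have sVP: V \subset P by apply/subsetP=> _ /V0P[u Pu [-> _]]; rewrite groupX.
have abelV: p.-abelem V.
  apply/(abelemP p_pr); split=> [|v /V0P[u _ []] //]; exact: abelianS sVP cPP.
have nVG: G \subset 'N(V).
  apply/subsetP=> g Gg; rewrite inE; apply/subsetP=> v0.
  case/imsetP=> v /V0P[u Pu [-> up1]] ->.
  apply/V0P; exists (u ^ g); first by rewrite memJ_norm ?(subsetP nPG).
  by rewrite -!conjXg up1 conj1g.
have VaC: {in V, forall v, [~ v, a] \in C}.
  by move=> _ /V0P[u Pu [-> _]]; rewrite commX // QqC ?Qcomm.
have cVa := cent_cyclic_commutator abelV nVG Gb Gc bc_a p'a cycC VaC.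
pose z := y ^+ (#[y] %/ p).
have oz: #[z] = p.
  rewrite orderXdiv ?dvdn_div // -{1}(divnK p_y) mulKn //.
  by rewrite divn_gt0 ?prime_gt0 // dvdn_leq.
have Vz: z \in V.
  apply/V0P; exists ([~ x, a] ^+ (#[y] %/ p));
    first by rewrite groupX ?(subsetP sQP) ?Qcomm.
  by rewrite -{2}oz expg_order /z /y commX // -!expgM mulnC.
have: z \in 'C_Q(<[a]>).
  by rewrite inE groupX //= cent_cycle; apply/cent1P/commute_sym;
    exact: (centP cVa).
rewrite coprime_abel_cent_TI ?cycle_subG // => /set1P z1.
by rewrite z1 order1 in oz; rewrite -oz in p_pr.
Qed.
End OneGroup.
End Delta.

(** * The exponent of delta_j^*(G) modulo its derived subgroup *)

Section Main.
Local Open Scope group_scope.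

Section OneGroup.
Variables (gT : finGroupType) (G : {group gT}) (m : nat).
Notation D j := (delta_star_comms G j).
Notation Y j := (powers_of (D j)).

(** If a is a p'-element then [~ a, b] = a^-1 * a ^ b is a product of two
    p'-elements of Y j; the case of b is symmetric. *)
Lemma coprime_cent_delta j (p : nat) y :
    prime p -> (forall a, a \in Y j -> p^'.-elt a -> commute y a) ->
  y \in 'C(delta_star G j.+1).
Proof.
move=> p_pr cYy; rewrite cent_gen; apply/centP=> x.
case/delta_star_commsP=> a [b [Ya Yb co_ab ->]].
have GY := subsetP (powers_of_delta_sub G j).
have YV c : c \in Y j -> c^-1 \in Y j.
  by move/powers_of_cycle; apply; rewrite groupV cycle_id.
case: (coprime_p'elt p_pr co_ab) => [p'a | p'b].
  by rewrite commgEl; apply: commuteM; apply: cYy;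
    rewrite ?p_eltV ?p_eltJ ?YV ?powers_of_deltaJ ?GY.
by rewrite commgEr; apply: commuteM; apply: cYy;
  rewrite ?p_eltJ ?p_eltV ?powers_of_deltaJ ?YV ?GY.
Qed.

(** Modulo the subgroup Q = [~: P, <[c]>] the element x = [~ b, c] would commute
    with c and be trivial by [coprime_comm1]; but b need not normalize Q, so b
    is corrected by an element w of P for which [~ b * w^-1, c] commutes with c.
    This gives x in Q, where c has no nontrivial fixed point. *)
Lemma coprime_comm_exponent j (P : {group gT}) (p : nat) b c :
    cyclically_covered m (D j.+2) -> p.-group P -> abelian P -> P <| G ->
    b \in G -> c \in Y j.+1 -> p^'.-elt c -> [~ b, c] \in P ->
  [~ b, c] ^+ m`! = 1.
Proof.
move=> cov pP cPP nsPG Gb Yc p'c; set x := [~ b, c] => Px.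
have Gc := subsetP (powers_of_delta_sub G j.+1) c Yc.
have nPc: c \in 'N(P) := subsetP (normal_norm nsPG) c Gc.
have coPc: coprime #|P| #[c] := pnat_coprime pP p'c.
pose Q := [~: P, <[c]>]%G.
have sQP: Q \subset P by rewrite commg_subl cycle_subG.
have Qcomm v: v \in P -> [~ v, c] \in Q.
  by move=> Pv; rewrite mem_commg ?cycle_id.
have [v Qv xv] := coprime_comm_onto cPP nPc coPc (Qcomm x Px).
have [w Qw vw] := coprime_comm_onto cPP nPc coPc Qv.
have [Pv Pw] := (subsetP sQP v Qv, subsetP sQP w Qw).
have comm_bw: [~ b * w^-1, c] = x * v^-1.
  rewrite commMgJ -/x conjgE (centsP cPP _ Px) ?groupV // mulKg; congr (_ * _).
  apply: (mulIg v); rewrite mulVg {1}vw -(abelian_commM cPP) ?groupV //.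
  by rewrite mulVg comm1g.
have comm_u: [~ x * v^-1, c] = 1.
  by rewrite (abelian_commM cPP) ?groupV // xv -(abelian_commM cPP) ?groupV //
    mulgV comm1g.
have u1: x * v^-1 = 1.
  rewrite -comm_bw; apply: coprime_comm1; rewrite comm_bw;
    first exact/commgP/eqP.
  by rewrite (coprime_dvdl _ coPc) // order_dvdG // groupM ?groupV.
have Qx: x \in Q by have /eqP := u1; rewrite -eq_mulgV1 => /eqP->.
apply/set1P; rewrite -[[set 1]](coprime_abel_cent_TI _ coPc cPP) ?cycle_subG //.
rewrite inE groupX //= cent_cycle; apply/cent1P/commgP/eqP.
exact: (power_cent_of_covered cov pP).
Qed.

End OneGroup.

Lemma delta_pgroup_exponent (gT : finGroupType) (G : {group gT}) m j (p : nat)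
    x :
    cyclically_covered m (delta_star_comms G j.+2) ->
    p.-group (delta_star G j.+2) -> abelian (delta_star G j.+2) ->
    x \in delta_star_comms G j.+2 ->
  x ^+ m`! = 1.
Proof.
set K := delta_star G j.+2 => cov pK cKK Dx.
have Kx: x \in K by rewrite mem_gen.
have [-> | ntx] := eqVneq x 1; first by rewrite expg1n.
have p_pr: prime p.
  have [|//] := @pgroup_pdiv _ p <<delta_star_comms G j.+2>>%G pK.
  by apply: contraNneq ntx => K1; rewrite -in_set1 -[[set 1]]K1.
have nsKG: <<delta_star_comms G j.+2>>%G <| G := delta_star_normal _ _.
have GY := subsetP (powers_of_delta_sub G j.+1).
case/delta_star_commsP: Dx => a [b [Ya Yb co_ab def_x]].
have [p'a | p'b] := coprime_p'elt p_pr co_ab; last first.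
  by rewrite def_x (coprime_comm_exponent cov pK) ?GY -?def_x.
apply: invg_inj; rewrite -expVgn invg1 def_x invg_comm.
by rewrite (coprime_comm_exponent cov pK) ?GY // -invg_comm -def_x groupV.
Qed.

(** For each prime p the quotient of G by the p'-part of delta_j^*(G) satisfies
    [delta_pgroup_exponent], so the order of x ^+ m`! is prime to p. *)
Lemma delta_abelian_exponent (gT : finGroupType) (G : {group gT}) m j x :
    cyclically_covered m (delta_star_comms G j.+2) ->
    abelian (delta_star G j.+2) -> x \in delta_star_comms G j.+2 ->
  x ^+ m`! = 1.
Proof.
move=> cov cKK Dx; pose K := <<delta_star_comms G j.+2>>%G.
have nsKG: K <| G := delta_star_normal _ _.
have Kx: x \in K by rewrite mem_gen.
apply/eqP; rewrite -order_eq1 eqn_leq order_gt0 andbT leqNgt.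
apply/negP=> /pdivP[p p_pr p_y]; pose H := 'O_p^'(K)%G.
have nsHG: H <| G := char_normal_trans (pcore_char _ _) nsKG.
have Nx: x \in 'N(H).
  by rewrite (subsetP (normal_norm nsHG)) // (subsetP (normal_sub nsKG)).
have Hy: x ^+ m`! \in H.
  apply: coset_idr; first exact: groupX.
  rewrite morphX //; apply: (delta_pgroup_exponent (covered_quotient nsHG cov)
    (p := p)).
  - rewrite delta_star_quotient // /pgroup -[_ / _]/(K / H) card_quotient.
      have /and3P[_ _] := nilpotent_pcore_Hall p^' (abelian_nil cKK).
      by rewrite pnatNK.
    exact: subset_trans (normal_sub nsKG) (normal_norm nsHG).
  - by rewrite delta_star_quotient // quotient_abelian.
  by rewrite delta_star_comms_quotient ?imset_f.
have := mem_p_elt (pcore_pgroup _ _) Hy.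
by rewrite /p_elt p'natE // p_y.
Qed.

Lemma delta_exponent_mod_der1 (gT : finGroupType) (G : {group gT}) m j x :
    cyclically_covered m (delta_star_comms G j.+2) ->
    x \in delta_star_comms G j.+2 ->
  x ^+ m`! \in (delta_star G j.+2)^`(1).
Proof.
move=> cov Dx; pose K := <<delta_star_comms G j.+2>>%G.
have nsKG: K <| G := delta_star_normal _ _.
have nsK'G: K^`(1)%G <| G := char_normal_trans (der_char _ _) nsKG.
have Nx: x \in 'N(K^`(1)).
  by rewrite (subsetP (normal_norm nsK'G)) // (subsetP (normal_sub nsKG))
    ?mem_gen.
apply: coset_idr; first exact: groupX.
rewrite morphX //; apply: (delta_abelian_exponent (covered_quotient nsK'G cov)).
  by rewrite delta_star_quotient // sub_der1_abelian.
by rewrite delta_star_comms_quotient ?imset_f.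
Qed.

End Main.

Section Final.
Local Open Scope group_scope.

(** * Central powers of the commutators *)

Section CentralPower.
Variables (gT : finGroupType) (G : {group gT}) (m j : nat).
Notation D := (delta_star_comms G j.+2).
Notation K := <<delta_star_comms G j.+2>>%G.
Hypothesis cov : cyclically_covered m D.

Let nsKG : K <| G.
Proof. exact: delta_star_normal. Qed.

Let cycles : {set {set gT}} := [set <[x]> | x in D].
Let G0 := ('C_G(cycles | 'Js))%G.
Let N := (K :&: G0)%G.

Let G0P g : reflect (g \in G /\ forall x, x \in D -> g \in 'N(<[x]>))
  (g \in G0).
Proof.
apply: (iffP setIP) => [[Gg /astabP cg]|[Gg Ng]]; split=> //.
  by move=> x Dx; apply/normP; apply: cg; apply: imset_f.
by apply/astabP=> _ /imsetP[x Dx ->]; apply/normP/Ng.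
Qed.

Let nsNG : N <| G.
Proof.
rewrite /normal subIset ?(normal_sub nsKG) //=.
rewrite normsI ?(normal_norm nsKG) // normsI ?normG //.
apply: subset_trans (astab_norm _ _).
apply/subsetP=> g Gg; rewrite !inE /=; apply/subsetP=> _ /imsetP[x Dx ->].
by rewrite inE /= -cycleJ imset_f // delta_star_commsJ.
Qed.

Let cent_derN : N^`(1) \subset 'C(K).
Proof.
rewrite gen_subG /= cent_gen; apply/subsetP=> z.
case/imset2P=> g h /setIP[_ G0g] /setIP[_ G0h] ->.
have [[_ Ng] [_ Nh]] := (G0P _ G0g, G0P _ G0h).
by apply/centP=> x Dx; apply: commg_norm_cycle; [apply: Ng | apply: Nh].
Qed.

Let nilN : nilpotent N.
Proof.
rewrite -quotient_center_nil abelian_nil // sub_der1_abelian // subsetI der_sub.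
by rewrite (subset_trans cent_derN) // centS // subsetIl.
Qed.

(** With P = O_p(N), [power_cent_of_covered] applies to P / P^`(1) in G / P^`(1)
    and gives w = [~ y ^+ q, a] in P^`(1). It applies then to w, so a
    centralizes w ^+ q, which is [~ y ^+ (q * q), a] because w is central
    in K. *)
Lemma p_elt_power_central (p : nat) y :
  prime p -> p.-elt y -> y \in N -> y ^+ (m`! * m`!) \in 'C(K).
Proof.
move=> p_pr py Ny; set q := m`!; pose P := 'O_p(N)%G; pose P1 := P^`(1)%G.
have nsPG: P <| G := char_normal_trans (pcore_char _ _) nsNG.
have nsP1G: P1 <| G := char_normal_trans (der_char _ _) nsPG.
have pP: p.-group P := pcore_pgroup _ _.
have sPK: P \subset K := subset_trans (pcore_sub _ _) (subsetIl _ _).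
have Py: y \in P.
  have hallP := nilpotent_pcore_Hall p nilN.
  by rewrite /= (mem_normal_Hall hallP (pcore_normal _ _)).
have cKP1: P1 \subset 'C(K).
  by apply: subset_trans cent_derN; rewrite dergS ?pcore_sub.
have sP1P: P1 \subset P := der_sub 1 P.
have cP1P1: abelian P1.
  by apply: subset_trans cKP1 _; rewrite centS ?(subset_trans sP1P).
have pP1: p.-group P1 := pgroupS sP1P pP.
have Gy := subsetP (normal_sub nsPG) y Py.
apply: (coprime_cent_delta p_pr) => a Ya p'a.
have Ga := subsetP (powers_of_delta_sub G j.+1) a Ya.
have nP1 := subsetP (normal_norm nsP1G).
set u := y ^+ q; set w := [~ u, a].
have P1w: w \in P1.
  apply: coset_idr; first by rewrite nP1 ?groupR ?groupX.
  rewrite morphR ?nP1 ?groupX // morphX ?nP1 //.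
  apply: (power_cent_of_covered (covered_quotient nsP1G cov)
    (quotient_pgroup _ pP)).
  - exact: sub_der1_abelian.
  - exact: quotient_normal.
  - exact: mem_powers_of_delta_quotient.
  - by apply: morph_p_elt; rewrite ?nP1.
  exact: mem_quotient.
have wq_a := power_cent_of_covered cov pP1 cP1P1 nsP1G Ya p'a P1w.
have cwu: commute u w.
  by apply: commute_sym; apply: (centP (subsetP cKP1 w P1w));
    rewrite groupX ?(subsetP sPK).
have comm_uq: [~ u ^+ q, a] = w ^+ q.
  by rewrite commgEl conjXg conjg_mulR expgMn // mulKg.
rewrite expgM; apply/commgP/eqP; apply: coprime_comm1; rewrite comm_uq.
  exact/commgP/eqP.
exact: pnat_coprime (mem_p_elt pP1 (groupX _ P1w)) p'a.
Qed.

(** One factor m`! brings x into N; the other two come from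
    [p_elt_power_central], applied to the primary components. *)
Lemma power_central x : x \in D -> x ^+ (m`! ^ 3)%N \in 'Z(K).
Proof.
move=> Dx; have Kx: x \in K by rewrite mem_gen.
have Gx := subsetP (normal_sub nsKG) x Kx.
have Nxq: x ^+ m`! \in N.
  rewrite inE groupX //=; apply/G0P; split=> [|z Dz]; first exact: groupX.
  apply: expg_fact_norm_cycle cov _ => h xh; apply: delta_star_commsJ => //.
  by apply: subsetP xh; rewrite cycle_subG.
rewrite inE groupX //= expnS -mulnn expgM -[_ ^+ _]prod_constt.
apply: group_prod => p _; rewrite consttX.
have [p_pr|p_npr] := boolP (prime p).
  by apply: p_elt_power_central p_pr _ _; [apply: p_elt_constt | apply: groupX].
have /constt1P->: p^'.-elt (x ^+ m`!); last by rewrite expg1n.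
by rewrite /p_elt p'natEpi // mem_primes (negPf p_npr).
Qed.
End CentralPower.

(** * The bound *)

Definition dietzmann_bound (m e : nat) := ((m * e).+1 ^ (m * e * e))%N.

Lemma card_delta_star_bound (gT : finGroupType) (G : {group gT}) m j e :
    cyclically_covered m (delta_star_comms G j) -> 0 < e ->
    {in delta_star_comms G j, forall x, x ^+ e = 1} ->
  #|delta_star G j| <= dietzmann_bound m e.
Proof.
move=> cov e_gt0 De1; apply: card_gen_normal_set => //.
  2: exact: card_covered.
by move=> a b Da /(subsetP (delta_star_comms_sub _ _)) Gb;
  apply: delta_star_commsJ.
Qed.

End Final.

Theorem theorem1p3 :
  exists f : nat -> nat,
    forall (j m : nat), 2 <= j -> 1 <= m ->
    forall (gT : finGroupType) (G : {group gT}) (C : 'I_m -> {group gT}),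
      (forall i : 'I_m, C i \subset G) ->
      (forall i : 'I_m, cyclic (C i)) ->
      delta_star_comms G j \subset \bigcup_(i < m) C i ->
      #|delta_star G j| <= f m.
Proof.
pose index_bound m := dietzmann_bound m (m`! ^ 3).
exists (fun m => dietzmann_bound m (m`! * (index_bound m)`!)).
move=> [|[|j]] // m _ _ gT G C _ cycC sDC.
have cov: cyclically_covered m (delta_star_comms G j.+2) by exists C.
pose K := <<delta_star_comms G j.+2>>%G.
have nsKG: (K <| G)%g := delta_star_normal _ _.
have nsZG: ('Z(K)%G <| G)%g := char_normal_trans (center_char K) nsKG.
have le_index: #|K : 'Z(K)|%g <= index_bound m.
  rewrite -card_quotient ?normal_norm ?center_normal //.
  rewrite -[(_ / _)%g]/(delta_star G j.+2 / 'Z(K)%G)%g -delta_star_quotient //.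
  apply: card_delta_star_bound; rewrite ?expn_gt0 ?fact_gt0 //;
    first exact: covered_quotient.
  rewrite delta_star_comms_quotient // => _ /imsetP[x Dx ->].
  have Nx: x \in ('N('Z(K)))%g.
    by rewrite (subsetP (normal_norm nsZG)) // (subsetP (normal_sub nsKG))
      ?mem_gen.
  by rewrite -(coset_id (power_central cov Dx)) morphX.
apply: card_delta_star_bound; rewrite ?muln_gt0 ?fact_gt0 // => x Dx.
(* Only an upper bound on the index of the centre is known, so its multiple
   (index_bound m)`! serves as a uniform exponent. *)
have/dvdnP[k ->]: #|K : 'Z(K)|%g %| (index_bound m)`!.
  by rewrite dvdn_fact // indexg_gt0.
rewrite mulnCA mulnC expgM expgM.
by rewrite expg_index_center_der1 ?expg1n // delta_exponent_mod_der1.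
Qed.
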